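(* There exist a finite non-abelian simple group $G$ and a second maximal subgroup $M$ of $G$ such that $d(M)=74207281$.
   Context: For a finite group $X$, $d(X)$ is the minimal number of generators of $X$. A subgroup $M$ of $G$ is second maximal (depth 2) if there is a subgroup $H$ with $M<H<G$, where $M$ is maximal in $H$ and $H$ is maximal in $G$. It may be taken as known that $2^{74207281}-1$ is a (Mersenne) prime. *)

(* Defs.v *)
From mathcomp Require Import all_boot all_fingroup all_solvable.

Set Implicit Arguments.
Unset Strict Implicit.
Unset Printing Implicit Defensive.

(* The chain M < H < G is proper since [maximal A B] includes A \proper B. *)
Definition second_maximal (gT : finGroupType) (M G : {group gT}) : Prop :=
  exists H : {group gT}, maximal M H /\ maximal H G.

(* Main.v *)
(** Let F be the field with 2^n elements, where 2^n - 1 is prime, and let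
    G = SL_2(F), B its upper triangular Borel subgroup and U the unipotent
    radical of B. By the Bruhat decomposition, an element of G outside B
    yields, together with B, a nontrivial lower unitriangular matrix, hence all
    of them by torus conjugation since every element of F is a square; so B is
    maximal in G. U is maximal in B because its index 2^n - 1 is prime, and U is
    elementary abelian of order 2^n, so it needs exactly n generators. G is
    simple: taking commutators, a nontrivial normal subgroup contains a
    nontrivial element of U, hence U, its opposite, and therefore G. *)

Require Import Defs.
From HB Require Import structures.
From mathcomp Require Import all_boot all_fingroup all_solvable.
From mathcomp Require Import all_algebra finfield ring.

Set Implicit Arguments.
Unset Strict Implicit.
Unset Printing Implicit Defensive.

Import GRing.Theory.

(** * The group of 2 by 2 matrices of determinant 1 *)

Section SpecialLinear2.

Local Open Scope ring_scope.

Variable F : finFieldType.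

(* [(a, b, c, d)] stands for the matrix [[a, b], [c, d]]. *)
Record sl2 := Sl2 {
  entries : F * F * F * F;
  _ : let: (a, b, c, d) := entries in a * d - b * c == 1 }.

HB.instance Definition _ := [isSub for entries].
HB.instance Definition _ := [Finite of sl2 by <:].

Definition mk_sl2 a b c d (e : a * d - b * c = 1) : sl2 :=
  @Sl2 (a, b, c, d) (introT eqP e).

(** Elimination that delivers the determinant condition as a rewritable equation. *)
Lemma sl2P (P : sl2 -> Prop) :
  (forall a b c d (e : a * d - b * c = 1), P (mk_sl2 e)) -> forall x, P x.
Proof.
move=> Pmk [[[[a b] c] d] e].
have -> : @Sl2 (a, b, c, d) e = mk_sl2 (eqP e) by apply: val_inj.
exact: Pmk.
Qed.

Definition mul_entries (x y : F * F * F * F) :=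
  let: (a, b, c, d) := x in let: (a', b', c', d') := y in
  (a * a' + b * c', a * b' + b * d', c * a' + d * c', c * b' + d * d').

Fact sl2_mul_subproof (x y : sl2) :
  let: (a, b, c, d) := mul_entries (val x) (val y) in a * d - b * c == 1.
Proof.
case: x y => [[[[a b] c] d] /= /eqP e] [[[[a' b'] c'] d'] /= /eqP e'].
(* With 1 written as the product of both determinants, multiplicativity is a polynomial identity. *)
apply/eqP; rewrite -[1]mul1r -{1}e -e'; ring.
Qed.

Definition sl2_mul (x y : sl2) : sl2 := Sl2 (sl2_mul_subproof x y).

Fact sl2_one_subproof : 1 * 1 - 0 * 0 = 1 :> F.
Proof. ring. Qed.

Definition sl2_one := mk_sl2 sl2_one_subproof.

Fact sl2_inv_subproof (x : sl2) :
  let: (a, b, c, d) :=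
    (let: (a, b, c, d) := val x in (d, - b, - c, a)) in a * d - b * c == 1.
Proof.
by case: x => [[[[a b] c] d] /= /eqP e]; apply/eqP; rewrite -e; ring.
Qed.

Definition sl2_inv (x : sl2) : sl2 := Sl2 (sl2_inv_subproof x).

Fact sl2_mulA : associative sl2_mul.
Proof.
elim/sl2P=> a b c d e; elim/sl2P=> a' b' c' d' e'.
by elim/sl2P=> a'' b'' c'' d'' e''; apply: val_inj; congr (_, _, _, _); ring.
Qed.

Fact sl2_mul1 : left_id sl2_one sl2_mul.
Proof.
by elim/sl2P=> a b c d e; apply: val_inj; congr (_, _, _, _); ring.
Qed.

Fact sl2_mulV : left_inverse sl2_one sl2_inv sl2_mul.
Proof.
elim/sl2P=> a b c d e; apply: val_inj.
by congr (_, _, _, _); [rewrite -e | | | rewrite -e]; ring.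
Qed.

HB.instance Definition _ :=
  Finite_isGroup.Build sl2 sl2_mulA sl2_mul1 sl2_mulV.

Lemma val_mul (x y : sl2) : val (x * y)%g = mul_entries (val x) (val y).
Proof. by []. Qed.

Lemma val_inv (x : sl2) :
  val (x^-1)%g = let: (a, b, c, d) := val x in (d, - b, - c, a).
Proof. by []. Qed.

(** * Unitriangular, diagonal and Weyl elements *)

Definition low (x : sl2) := (val x).1.2.

Fact upper_subproof a : 1 * 1 - a * 0 = 1 :> F.
Proof. ring. Qed.

Definition upper a := mk_sl2 (upper_subproof a).

Fact lower_subproof c : 1 * 1 - 0 * c = 1 :> F.
Proof. ring. Qed.

Definition lower c := mk_sl2 (lower_subproof c).

(* The identity at the junk value [t = 0]. *)
Definition torus t : sl2 := insubd sl2_one (t, 0, 0, t^-1).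

Lemma val_torus t : t != 0 -> val (torus t) = (t, 0, 0, t^-1).
Proof.
by move=> t0; rewrite val_insubd mulfV // mul0r subr0 eqxx.
Qed.

Fact weyl_subproof : 0 * 0 - 1 * (-1) = 1 :> F.
Proof. ring. Qed.

Definition weyl := mk_sl2 weyl_subproof.

Lemma upperD a b : (upper a * upper b)%g = upper (a + b).
Proof. by apply: val_inj; rewrite val_mul /=; congr (_, _, _, _); ring. Qed.

Lemma upper_inj : injective upper.
Proof. by move=> a b /(congr1 val) [->]. Qed.

Lemma torus_upper t a : t != 0 ->
  (torus t * upper a * (torus t)^-1)%g = upper (t ^+ 2 * a).
Proof.
move=> t0; apply: val_inj; rewrite !val_mul val_inv val_torus //=.
by congr (_, _, _, _); field.
Qed.

Lemma torus_lower t c : t != 0 ->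
  ((torus t)^-1 * lower c * torus t)%g = lower (t ^+ 2 * c).
Proof.
move=> t0; apply: val_inj; rewrite !val_mul val_inv val_torus //=.
by congr (_, _, _, _); field.
Qed.

Lemma weyl_upper a : (weyl * upper a * weyl^-1)%g = lower (- a).
Proof.
apply: val_inj; rewrite !val_mul val_inv /=; congr (_, _, _, _); ring.
Qed.

(** With [c = low x], the product has diagonal [1 + y * c], [1 + c * z], which forces [y] and [z];
    the determinant then fixes the last entry. *)
Lemma bruhat x : low x != 0 ->
  exists y z, x = (upper y * lower (low x) * upper z)%g.
Proof.
elim/sl2P: x => a b c d e; rewrite /low /= => c0.
exists ((a - 1) / c), ((d - 1) / c); apply: val_inj; rewrite !val_mul /=.
have be : b = (a * d - 1) / c by rewrite -e; field.
by congr (_, _, _, _); rewrite ?be; field.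
Qed.

Lemma gen_upper_lower (H : {group sl2}) :
  (forall a, upper a \in H) -> (forall c, lower c \in H) -> H :=: setT.
Proof.
move=> HU HL; apply/setP=> x; rewrite inE.
have low_in y : low y != 0 -> y \in H.
  by move=> /bruhat[u [v ->]]; rewrite !groupM.
have [x0|/low_in//] := eqVneq (low x) 0.
(* An upper triangular [x] enters the big cell on right multiplication by [lower 1]: the lower left
   entry becomes [d], a unit. *)
rewrite -(groupMr _ (HL 1)) low_in //.
elim/sl2P: x x0 => a b c d e; rewrite /low val_mul /= => c0.
rewrite c0 mul0r add0r mulr1; apply/eqP=> d0.
by move/eqP: e; rewrite c0 d0 !mulr0 subr0 eq_sym oner_eq0.
Qed.

(** * The Borel subgroup and its unipotent radical *)

Definition borel_set := [set x | low x == 0].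

Fact borel_group_set : group_set borel_set.
Proof.
apply/group_setP; split=> [|x y]; first by rewrite inE /low.
elim/sl2P: x => a b c d e; elim/sl2P: y => a' b' c' d' e'.
rewrite !inE /low val_mul /= => /eqP-> /eqP->.
by rewrite mul0r mulr0 addr0.
Qed.

Canonical borel := Group borel_group_set.

Definition unipotent_set := [set upper a | a in F].

Fact unipotent_group_set : group_set unipotent_set.
Proof.
apply/group_setP; split=> [|_ _ /imsetP[a _ ->] /imsetP[b _ ->]].
  by apply/imsetP; exists 0 => //; apply: val_inj.
by rewrite upperD imset_f.
Qed.

Canonical unipotent := Group unipotent_group_set.

Lemma card_unipotent : #|unipotent| = #|F|.
Proof. by rewrite card_imset //; apply: upper_inj. Qed.

Lemma card_borel : #|borel| = (#|F| * #|F|.-1)%N.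
Proof.
(* Unique factorization: the top row of [torus t * upper a] is [t], [t * a], which recovers [t] and
   [a]. *)
have -> : borel = [set (torus p.2 * upper p.1)%g | p in setX setT [set~ 0]]
  :> {set _}.
  apply/setP=> x; apply/idP/imsetP=> [|[[a t]]]; last first.
    rewrite !inE /= => t0 ->.
    by rewrite /low val_mul val_torus //= !mul0r mulr0 addr0.
  elim/sl2P: x => a b c d e; rewrite inE /low /= => /eqP c0.
  have ad : a * d = 1 by rewrite -e c0 mulr0 subr0.
  have a0 : a != 0.
    by apply: contra_eq_neq ad => ->; rewrite mul0r eq_sym oner_eq0.
  have da : d = a^-1 by rewrite -[a^-1]mulr1 -ad mulKf.
  exists (b / a, a); first by rewrite !inE.
  apply: val_inj; rewrite val_mul val_torus //= c0 da.
  by congr (_, _, _, _); field.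
rewrite card_in_imset => [|[a t] [b s]]; first by rewrite cardsX cardsT cardsC1.
rewrite !inE /= => t0 s0 /(congr1 val); rewrite !val_mul !val_torus //=.
by case; rewrite !(mulr1, mul0r, addr0) => <- /(mulfI t0)->.
Qed.

Lemma torus_borel t : t != 0 -> torus t \in borel.
Proof. by move=> t0; rewrite inE /low val_torus. Qed.

Lemma unipotent_sub_borel : unipotent \subset borel.
Proof. by apply/subsetP=> _ /imsetP[a _ ->]; rewrite inE. Qed.

Lemma unipotent_maximal : prime #|F|.-1 -> maximal unipotent borel.
Proof.
move=> pF; apply: p_index_maximal unipotent_sub_borel _.
rewrite -divgS ?unipotent_sub_borel // card_unipotent card_borel.
by rewrite mulKn // (leq_trans _ (finNzRing_gt1 F)).
Qed.

Lemma weyl_notin_borel : weyl \notin borel.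
Proof. by rewrite inE /low /= oppr_eq0 oner_eq0. Qed.

Lemma sl2_not_abelian : ~~ abelian [set: sl2].
Proof.
apply/negP=> /centsP/(_ (upper 1) (in_setT _) weyl (in_setT _))/(congr1 val).
rewrite !val_mul /= => -[/eqP].
by rewrite !(mul1r, mul0r, mulr0, mulr1) !add0r oppr_eq0 oner_eq0.
Qed.

(** * Characteristic 2: maximality of the Borel subgroup, simplicity *)

Section Char2.

Hypothesis F2 : 2 \in [pchar F].

Lemma sqr_inj_pchar2 : injective (fun b : F => b ^+ 2).
Proof. exact: (fmorph_inj (pFrobenius_aut F2)). Qed.

(** Injectivity on a finite set gives surjectivity. Torus conjugation, which scales by squares, thus
    reaches every nonzero scalar. *)
Lemma sqrt_pchar2 (a : F) : exists b, b ^+ 2 = a.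
Proof.
by have [g _ gK] := injF_bij sqr_inj_pchar2; exists (g a); rewrite gK.
Qed.

Lemma unipotent_abelem : (2.-abelem unipotent)%g.
Proof.
rewrite abelemE //; apply/andP; split.
  apply/centsP=> _ /imsetP[a _ ->] _ /imsetP[b _ ->].
  by rewrite /commute !upperD addrC.
apply/exponentP=> _ /imsetP[a _ ->].
by rewrite expgS expg1 upperD addrr_pchar2 //; apply: val_inj.
Qed.

Lemma borel_maximal : maximal borel [set: sl2].
Proof.
apply/maxgroupP; split=> [|H].
  by rewrite properE subsetT; apply: contra weyl_notin_borel => /subsetP->.
rewrite properT => HT BH; apply/eqP; rewrite eqEsubset BH andbT.
apply/subsetP=> x Hx; rewrite inE; apply: contraNT HT => x0.
have HU a : upper a \in H by apply: (subsetP BH); rewrite inE.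
have Hc : lower (low x) \in H.
  by have [y [z xE]] := bruhat x0; move: Hx; rewrite {1}xE groupMr // groupMl.
apply/eqP/gen_upper_lower => // c.
have [->|c0] := eqVneq c 0; first by have -> : lower 0 = 1%g by apply: val_inj.
have [t tE] := sqrt_pchar2 (c / low x).
have t0 : t != 0.
  by rewrite -sqrf_eq0 tE mulf_neq0 // invr_neq0.
have -> : c = t ^+ 2 * low x by rewrite tE divfK.
have Ht : torus t \in H by rewrite (subsetP BH) // torus_borel.
by rewrite -torus_lower // !groupM // groupV.
Qed.

(** Normality for conjugation from the left, the form of the matrix identities above. *)
Lemma normal_mulgV (N : {group sl2}) :
  (N <| [set: sl2])%g ->
  forall g y, y \in N -> (g * y * g^-1)%g \in N.
Proof.
move=> /normal_norm nN g y Ny.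
by rewrite -{1}[g]invgK -mulgA -conjgE memJ_norm // (subsetP nN) ?inE.
Qed.

Lemma low_normal (N : {group sl2}) :
  (N <| [set: sl2])%g -> N :!=: 1%g -> exists2 x, x \in N & low x != 0.
Proof.
move=> nN /trivgPn[x Nx x1]; have NJ := normal_mulgV nN.
have [x0|] := eqVneq (low x) 0; last by exists x.
elim/sl2P: x Nx x1 x0 => a b c d e Nx x1; rewrite {1}/low /= => c0.
have [b0|b0] := eqVneq b 0; last first.
  exists (weyl * mk_sl2 e * weyl^-1)%g; first exact: NJ.
  rewrite /low !val_mul val_inv /= [X in X != 0](_ : _ = - b) ?oppr_eq0 //.
  by ring.
(* For diagonal [x] this conjugate has lower left entry [a - d]. If it vanished, [a ^+ 2 = 1] would
   give [a = 1] in characteristic 2, so [x] would be trivial. *)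
exists (lower 1 * mk_sl2 e * (lower 1)^-1)%g; first exact: NJ.
rewrite /low !val_mul val_inv /= b0 c0.
rewrite [X in X != 0](_ : _ = a - d); last by ring.
apply: contraNneq x1 => /subr0_eq ad.
have a1 : a = 1.
  by apply: sqr_inj_pchar2; rewrite expr1n expr2 {2}ad -e b0 mul0r subr0.
by apply/eqP/val_inj; rewrite /= b0 c0 -ad a1.
Qed.

Lemma sl2_simple : (2 < #|F|)%N -> simple [set: sl2].
Proof.
move=> gtF2; apply/simpleP; split=> [|N nN].
  apply: contraNneq sl2_not_abelian => ->; exact: abelian1.
have [->|N1] := eqVneq (N : {set sl2}) 1%g; [by left | right].
have [x Nx x0] := low_normal nN N1; have NJ := normal_mulgV nN.
have [t t0 t1] : exists2 t : F, t != 0 & t != 1.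
  have : (0 < #|~: [set (0 : F)%R; 1%R]|)%N.
    by rewrite cardsCs setCK cards2 eq_sym oner_eq0 subn_gt0.
  by case/card_gt0P=> t; rewrite !inE negb_or => /andP[]; exists t.
have [b Nb b0] : exists2 b, upper b \in N & b != 0.
  have [y Ny y1] : exists2 y, y \in N & low y = 0 /\ (val y).1.1.1 = t ^+ 2.
    elim/sl2P: x Nx x0 => a b c d e Nx; rewrite {1}/low /= => c0.
    (* Conjugating by a unipotent element clears the upper left entry; the
       commutator with a diagonal matrix is then upper triangular. *)
    set y := (upper (- (a / c)) * mk_sl2 e * (upper (- (a / c)))^-1)%g.
    have Ny : y \in N by apply: NJ.
    have vy : val y = (0, - c^-1, c, a + d).
      have be : b = (a * d - 1) / c by rewrite -e; field.
      by rewrite !val_mul val_inv /=; congr (_, _, _, _); rewrite ?be; field.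
    exists (y^-1 * ((torus t)^-1 * y * (torus t)^-1^-1))%g.
      by rewrite groupM ?groupV ?NJ.
    rewrite /low !val_mul !val_inv vy val_torus //=.
    by split; field; rewrite ?c0 ?t0.
  (* Conjugation by [y], with diagonal [t ^+ 2], [t ^- 2], scales [upper 1] by [t ^+ 4]; so the
     commutator of [y] and [upper 1] has this entry. It is nonzero because squaring is injective and
     [t != 1]. *)
  exists (t ^+ 4 - 1); last first.
    rewrite subr_eq0; apply: contra_neq t1 => t4.
    by do 2!apply: sqr_inj_pchar2; rewrite -exprM t4 !expr1n.
  have -> : upper (t ^+ 4 - 1) = (y * (upper 1 * y^-1 * (upper 1)^-1))%g.
    elim/sl2P: y y1 {Ny} => a b c d e; rewrite /low /= => -[c0 at2].
    have ad : a * d = 1 by rewrite -e c0 mulr0 subr0.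
    have da : d = (t ^+ 2)^-1.
      by rewrite -at2 -[RHS]mulr1 -ad mulKf // at2 expf_neq0.
    apply: val_inj; rewrite !val_mul !val_inv /= c0 at2 da.
    by congr (_, _, _, _); field.
  by rewrite groupM // NJ // groupV.
have NU a : upper a \in N.
  have [->|a0] := eqVneq a 0.
    by have -> : upper 0 = 1%g by apply: val_inj.
  have [s sE] := sqrt_pchar2 (a / b).
  have s0 : s != 0 by rewrite -sqrf_eq0 sE mulf_neq0 // invr_neq0.
  have -> : a = s ^+ 2 * b by rewrite sE divfK.
  by rewrite -torus_upper // NJ.
apply: gen_upper_lower => // c.
by rewrite -[c]opprK -weyl_upper NJ.
Qed.

End Char2.

End SpecialLinear2.

Theorem proposition2 (mersenne_prime : prime (2 ^ 74207281 - 1)) :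
  exists (gT : finGroupType) (G M : {group gT}),
    [/\ simple G, ~~ abelian G, second_maximal M G & 'm(M)%g = 74207281].
Proof.
(* The exponent becomes a variable, so the huge numeral is never computed with. *)
move: mersenne_prime; move: 74207281 => n; rewrite subn1 => pn.
have n_gt1 : 1 < n by case: n pn => [|[]].
have [F F2 cardF] := pPrimePowerField (isT : prime 2) (ltnW n_gt1).
have gtF2 : 2 < #|F| by rewrite cardF -[2]expn1 ltn_exp2l.
exists (sl2 F), [set: sl2 F]%G, (unipotent F); split.
- exact: sl2_simple.
- exact: sl2_not_abelian.
- exists (borel F); split; last exact: borel_maximal.
  by apply: unipotent_maximal; rewrite cardF.
- have U2 := unipotent_abelem F2.
  (* For an abelian group the generator number is the rank, here the base 2 logarithm of the
     order. *)
  rewrite grank_abelian ?(abelem_abelian U2) // (rank_abelem U2).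
  by rewrite card_unipotent cardF pfactorK.
Qed.
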